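(* The $0$-maximal polynomials of degree $n\ge 2$ are exactly the following: (i) if $n=2m$ with $m\ge 1$: the polynomials $z^{2m}+e^{i\theta}z$, where $\theta\in\mathbf{R}$; (ii) if $n=2m+1$ with $m\ge 1$: the polynomials $z^{2m+1}+\lambda e^{i\theta}z^{m+1}+e^{i2\theta}z$, where $\lambda,\theta\in\mathbf{R}$ and $|\lambda|\le\frac{2\sqrt{2m+1}}{m+1}$.
   Context: $S(n,0)$ is the set of monic complex polynomials $p$ of degree $n\ge 2$ having all their zeros in the closed unit disk and satisfying $p(0)=0$. For $p\in S(n,0)$ let $|p|_0=\min_{w\in Z(p')}|w|$, where $Z(p')$ is the zero set of $p'$. A polynomial $p\in S(n,0)$ is called $0$-maximal (of degree $n$) if $|p|_0\ge|q|_0$ for every $q\in S(n,0)$. *)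

(* Defs.v *)
From HB Require Import structures.
From mathcomp Require Import all_boot all_order all_algebra.
From mathcomp Require Import complex.
From mathcomp Require Import all_classical all_reals all_analysis.

Set Implicit Arguments.
Unset Strict Implicit.
Unset Printing Implicit Defensive.

Import Order.TTheory GRing.Theory Num.Theory.

Local Open Scope ring_scope.
Local Open Scope classical_set_scope.

(* [Normc.normc : R[i] -> R] is used rather than the generic norm [`|z|], which
   takes its values in [R[i]], so that moduli can be compared in [R]. *)

Definition S0 (R : realType) (n : nat) : set {poly R[i]} :=
  [set p | [/\ p \is monic, size p = n.+1,
               forall z : R[i], root p z -> Normc.normc z <= 1
             & p.[0] = 0]].

Definition crit_moduli (R : realType) (p : {poly R[i]}) : set R :=
  [set Normc.normc w | w in [set w | root (deriv p) w]].

(* $|p|_0$, as an infimum; [crit_min_attained] and [crit_min_le] show that it is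
   the minimum as soon as p has degree at least 2. *)
Definition crit_min (R : realType) (p : {poly R[i]}) : R := inf (crit_moduli p).

Definition zero_maximal (R : realType) (n : nat) (p : {poly R[i]}) : Prop :=
  S0 n p /\ forall q : {poly R[i]}, S0 n q -> crit_min q <= crit_min p.

Definition expi (R : realType) (t : R) : R[i] := Complex (cos t) (sin t).

Lemma normc_ge0 (R : realType) (z : R[i]) : 0 <= Normc.normc z.
Proof. by case: z => a b; exact: sqrtr_ge0. Qed.

Lemma crit_min_le (R : realType) (p : {poly R[i]}) (w : R[i]) :
  root (deriv p) w -> crit_min p <= Normc.normc w.
Proof.
move=> hw; apply: ge_inf; last by exists w.
by exists 0 => _ [z _ <-]; exact: normc_ge0.
Qed.

Lemma crit_min_attained (R : realType) (p : {poly R[i]}) :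
  (2 < size p)%N ->
  exists2 w : R[i], root (deriv p) w & crit_min p = Normc.normc w.
Proof.
move=> sp.
have sd : (1 < size (deriv p))%N.
  have h : (deriv p)`_(size p).-2 != 0.
    have s1 : (size p).-2.+1 = (size p).-1 by case: (size p) sp => [|[]].
    rewrite coef_deriv s1 -mulr_natr mulf_neq0 //.
      by rewrite -[_`_ _]/(lead_coef p) lead_coef_eq0 -size_poly_gt0 (ltn_trans _ sp).
    by rewrite pnatr_eq0 -lt0n; case: (size p) sp => [|[]].
  rewrite ltnNge; apply: contra h => h.
  apply/eqP/nth_default/(leq_trans h).
  by case: (size p) sp => [|[|[]]].
have d0 : deriv p != 0 by rewrite -size_poly_gt0 ltnW.
have [rs drs] := closed_field_poly_normal (deriv p).
have rootE w : root (deriv p) w = (w \in rs).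
  by rewrite {1}drs rootZ ?lead_coef_eq0 // root_prod_XsubC.
have [w0 hw0] : exists w, root (deriv p) w.
  by apply/closed_rootP; rewrite neq_ltn sd orbT.
have [w wrs hw] : exists2 w, w \in rs &
    forall z, z \in rs -> Normc.normc w <= Normc.normc z.
  rewrite rootE in hw0; move: hw0; clear.
  elim: rs w0 => // a [|b rs] IH w0 _.
    by exists a; rewrite ?mem_head // => z; rewrite inE => /eqP ->.
  have [w wrs hw] := IH b (mem_head _ _).
  have [le_aw|lt_wa] := leP (Normc.normc a) (Normc.normc w).
    exists a; first exact: mem_head.
    by move=> z; rewrite inE => /orP[/eqP -> //|/hw]; exact: le_trans.
  exists w; first by rewrite inE wrs orbT.
  by move=> z; rewrite inE => /orP[/eqP ->|/hw //]; exact: ltW.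
exists w; first by rewrite rootE.
apply/eqP; rewrite eq_le crit_min_le ?rootE //=.
apply: lb_le_inf; first by exists (Normc.normc w), w; rewrite //= rootE.
by move=> _ [z /= hz <-]; apply: hw; rewrite -rootE.
Qed.

(* Main.v *)
(* Put N = n - 1 and write p = z q. Comparing constant terms,
   n * prod |w| over the critical points w equals prod |z| over the zeros z of q,
   so n |p|_0^N <= 1, with equality iff all zeros of q are unimodular and
   n |w|^N = 1 for every critical point w. Hence q and p' have all their zeros on
   a circle about 0, i.e. both are self-inversive up to scaling. Comparing the two
   sets of coefficient relations, a nonzero coefficient q_k forces
   (n-k)^N = (k+1)^N n^(N-2k) when 2k <= N, which by strict convexity of
   log((n-k)/(k+1)) on [0, N/2] holds only for k = 0 and 2k = N. So only the
   coefficients of index 0, N/2 and N survive in q, and what remains for n = 2m+1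
   is a real quadratic in z^m e^(-i theta), whose roots have equal moduli iff its
   discriminant is nonpositive. *)

Require Import Defs.
From mathcomp Require Import all_boot all_order all_algebra.
From mathcomp Require Import complex.
From mathcomp Require Import all_classical all_reals all_analysis.
From mathcomp Require Import ring lra zify.

Import Order.TTheory GRing.Theory Num.Theory.

Local Open Scope ring_scope.

(* With x = k + 1 and d = n - 1 - 2k, [ratio x d] is (n-k)/(k+1), and
   [ratio_step x d] is its quotient by the value of the same ratio at k + 1. *)
Definition ratio {F : realFieldType} (x d : F) : F := (x + d) / x.
Definition ratio_step {F : realFieldType} (x d : F) : F :=
  (x + d) * (x + 1) / (x * (x + d - 1)).

(** * Discrete convexity of the logarithm of (n-k)/(k+1) *)

Section Ratio.
Variable F : realFieldType.
Implicit Types x d : F.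

(** For fixed n, passing from k to k + 1 replaces (x, d) by (x + 1, d - 2); writing d + 2 on the
    left avoids the subtraction. *)
Lemma ratio_stepM x d : 0 < x -> 0 <= d ->
  ratio x (d + 2) = ratio_step x (d + 2) * ratio (x + 1) d.
Proof.
move=> x0 d0; rewrite /ratio /ratio_step; field.
by rewrite !lt0r_neq0 //; lra.
Qed.

(** The factor d in the numerator decides the sign: steps decrease weakly for d >= 0 and strictly
    for d > 0. *)
Lemma ratio_step_diff x d : 0 < x -> 0 <= d ->
  ratio_step x (d + 2) - ratio_step (x + 1) d =
  (2 * x + d + 2) * d / (x * (x + 1) * (x + d) * (x + d + 1)).
Proof.
move=> x0 d0; rewrite /ratio_step; field.
by rewrite !lt0r_neq0 //; lra.
Qed.

Lemma ratio_gt0 x d : 0 < x -> 0 <= d -> 0 < ratio x d.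
Proof. by move=> x0 d0; rewrite divr_gt0 //; lra. Qed.

Lemma ratio_step_gt0 x d : 0 < x -> 1 <= d -> 0 < ratio_step x d.
Proof. by move=> x0 d1; rewrite divr_gt0 // mulr_gt0 //; lra. Qed.

Lemma ratio_step_le x d : 0 < x -> 0 <= d ->
  ratio_step (x + 1) d <= ratio_step x (d + 2).
Proof.
move=> x0 d0; rewrite -subr_ge0 ratio_step_diff //.
by rewrite divr_ge0 // !mulr_ge0 //; lra.
Qed.

Lemma ratio_step_lt x d : 0 < x -> 0 < d ->
  ratio_step (x + 1) d < ratio_step x (d + 2).
Proof.
move=> x0 d0; rewrite -subr_gt0 ratio_step_diff ?ltW //.
by rewrite divr_gt0 // !mulr_gt0 //; lra.
Qed.

(** The ratio is 1 at the middle d = 0, which lies d/2 steps away, and no later step exceeds the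
    first. Squaring makes sense of the half step: for d = 1 there is equality. *)
Lemma ratio_sqr_le x (d : nat) : 0 < x ->
  ratio x d%:R ^+ 2 <= ratio_step x d%:R ^+ d.
Proof.
elim/ltn_ind: d x => -[|[|d]] IH x x0.
- by rewrite /ratio addr0 divff ?gt_eqF // expr1n.
- rewrite /ratio /ratio_step expr1 le_eqVlt; apply/orP; left; apply/eqP.
  by field; rewrite ?lt0r_neq0 //; lra.
have d0 : 0 <= d%:R :> F by [].
rewrite -addn2 natrD ratio_stepM // exprMn addnC exprD.
have s0 : 0 < ratio_step x (d%:R + 2) by apply: ratio_step_gt0 => //; lra.
rewrite ler_pM2l ?exprn_gt0 //.
apply: le_trans (IH d _ (x + 1) _) _ => //; first by lra.
case: d {IH} d0 s0 => [|d] d0 s0; first by rewrite !expr0.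
apply: lerXn2r (ratio_step_le _ _ _ _) => //; rewrite nnegrE ltW //.
by apply: ratio_step_gt0; [lra | rewrite -natr1 lerDr].
Qed.

Lemma ratio_step_pow_decr x d k : 0 < x -> 1 <= d ->
  ratio (x + 1) d * ratio_step (x + 1) d ^+ k.+1
    < ratio x (d + 2) * ratio_step x (d + 2) ^+ k.
Proof.
move=> x0 d1; rewrite ratio_stepM //; last by lra.
rewrite [ltRHS]mulrAC [ltRHS]mulrC -exprS ltr_pM2l; last by apply: ratio_gt0; lra.
apply: ltrXn2r => //; first by apply/ltW/ratio_step_gt0; lra.
by apply: ratio_step_lt; lra.
Qed.

(** For fixed n, the quantity r c^k strictly decreases in k and equals n at k = 0. Descending in k
    raises d by 2, so the induction generalizes d. *)
Lemma ratio_step_pow_lt (k d : nat) : (0 < k)%N -> (0 < d)%N ->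
  ratio k.+1%:R d%:R * ratio_step k.+1%:R d%:R ^+ k < (2 * k + d).+1%:R :> F.
Proof.
case: k => // k _; elim: k d => [|k IH] d d0.
  rewrite -natr1; apply: lt_le_trans (ratio_step_pow_decr _ _ _ _ _) _ => //.
    by rewrite ler1n.
  by rewrite /ratio expr0 divr1 mulr1 -!natrD ler_nat; lia.
rewrite -(natr1 k.+2); apply: lt_trans (ratio_step_pow_decr _ _ _ _ _) _ => //.
  by rewrite ler1n.
have := IH (d + 2)%N; rewrite addn_gt0 orbT natrD => /(_ isT).
by rewrite (_ : (2 * k.+2 + d) = (2 * k.+1 + (d + 2)))%N //; lia.
Qed.

(* Convexity in discrete form: with n = 2k + d + 1, the ratio r at k and its step c
   satisfy r c^k < n and r^2 <= c^d, since the steps decrease up to the middle;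
   eliminating c gives the claim. *)
Lemma ratio_pow_lt (k d : nat) : (0 < k)%N -> (0 < d)%N ->
  ratio k.+1%:R d%:R ^+ (2 * k + d) < (2 * k + d).+1%:R ^+ d :> F.
Proof.
move=> k0 d0; set r := ratio _ _; set n := _%:R.
have r0 : 0 < r by apply: ratio_gt0.
have := ratio_sqr_le k.+1%:R d; rewrite -/r ltr0n => /(_ isT) h1.
have := ratio_step_pow_lt k d k0 d0; rewrite -/r -/n => h2.
set c := ratio_step _ _ in h1 h2.
have c0 : 0 < c by apply: ratio_step_gt0; rewrite ?ler1n.
(* The chain is r^(2k+d) = (r^2)^k r^d <= (c^d)^k r^d = (r c^k)^d < n^d. *)
clearbody c r; apply: le_lt_trans (_ : (r * c ^+ k) ^+ d < _).
  rewrite exprD exprMn [leLHS]mulrC ler_pM2l ?exprn_gt0 // exprM [leRHS]exprAC.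
  by apply: lerXn2r; rewrite // nnegrE exprn_ge0 // ltW.
by rewrite ltrXn2r ?mulr_ge0 ?exprn_ge0 ?ltW -?lt0n.
Qed.

End Ratio.

Lemma ratio_pow_neq (N k : nat) : (0 < k)%N -> (2 * k < N)%N ->
  ((N.+1 - k) ^ N <> k.+1 ^ N * N.+1 ^ (N - 2 * k))%N.
Proof.
move=> k0 kN E.
have := ratio_pow_lt rat k (N - 2 * k) k0; rewrite subn_gt0 kN => /(_ isT).
rewrite subnKC ?(ltnW kN) // /ratio -natrD expr_div_n.
rewrite ltr_pdivrMr ?exprn_gt0 ?ltr0n // -!natrX -natrM ltr_nat [ltnRHS]mulnC -E.
suff -> : (k.+1 + (N - 2 * k) = N.+1 - k)%N by rewrite ltnn.
by lia.
Qed.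

(** * Polynomials with all zeros on a circle about 0 *)

(** With M the degree and q^* the polynomial with conjugated coefficients, this is the coefficient
    of X^k in X^M q^*(r/X) = conj(q_0) q(X). Induction on the zeros avoids dividing by r. *)
Lemma self_inversive_coef (C : numClosedFieldType) (r : C) (s : seq C) (k : nat) :
  (forall z, z \in s -> z * z^* = r) -> (k <= size s)%N ->
  let q := \prod_(z <- s) ('X - z%:P) in
  (q`_(size s - k))^* * r ^+ (size s - k) = (q`_0)^* * q`_k.
Proof.
move=> + + q; rewrite {}/q; elim: s k => [|z s IH] k hs /=.
  by rewrite leqn0 => /eqP ->; rewrite big_nil coef1 rmorph1 !mulr1.
have zr : z * z^* = r by apply: hs; rewrite mem_head.
have {}IH j : (j <= size s)%N -> _ := IH j (fun w ws => hs w (@mem_behead _ (z :: s) w ws)).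
move=> lek.
rewrite big_cons; set q := \prod_(_ <- _) _ in IH *.
have szq : size q = (size s).+1 by rewrite size_prod_XsubC.
have qlead : q`_(size s) = 1.
  by have /monicP := monic_prod_XsubC s xpredT id; rewrite lead_coefE szq.
have qout : q`_(size s).+1 = 0 by rewrite nth_default ?szq.
rewrite !mulrBl !coefB !coefXM !coefCM !rmorphB !rmorphM /= rmorph0 sub0r.
have := IH 0%N isT; rewrite subn0 qlead rmorph1 mul1r => IH0.
(* A coefficient of (X - z) q involves two neighbouring coefficients of q. At the two extreme
   indices one of them is out of range, and monicity of q replaces the missing hypothesis. *)
case: k lek => [|k] lek.
  rewrite subn0 /= qlead qout rmorph0 rmorph1 exprS IH0 -zr; ring.
rewrite subSS /=; move: lek; rewrite ltnS leq_eqVlt => /predU1P[->|lek].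
  rewrite subnn /= qlead qout; ring.
have := IH k (ltnW lek); have := IH _ lek; rewrite -(subnSK lek) /= => IHk1 IHk.
by rewrite mulrBl -[_ * _ * _ ^+ _]mulrA IHk exprS mulrCA IHk1 -zr; ring.
Qed.

Lemma mulC_conj_normc (R : realType) (z : R[i]) :
  z * z^* = ((Normc.normc z) ^+ 2)%:C%C.
Proof. by rewrite -normCK rmorphXn. Qed.

Lemma prod_eq_bound (F : realFieldType) (a : F) (s : seq F) :
  0 < a -> (forall x, x \in s -> a <= x) -> \prod_(x <- s) x <= a ^+ size s ->
  forall x, x \in s -> x = a.
Proof.
move=> a0; elim: s => // y s IH hs; rewrite big_cons exprS => le_prod.
have ay : a <= y by apply: hs; rewrite mem_head.
have {}hs x : x \in s -> a <= x by move=> xs; apply: hs; rewrite inE xs orbT.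
have le_pow : a ^+ size s <= \prod_(x <- s) x.
  elim: s hs {IH le_prod} => [|x s IH] hs; first by rewrite big_nil.
  rewrite big_cons exprS; apply: ler_pM; rewrite ?exprn_ge0 ?(ltW a0) //.
    by apply: hs; rewrite mem_head.
  by apply: IH => z zs; apply: hs; rewrite inE zs orbT.
have pow0 : 0 < a ^+ size s by rewrite exprn_gt0.
have le_s : \prod_(x <- s) x <= a ^+ size s.
  rewrite -(ler_pM2l a0); apply: le_trans le_prod.
  by rewrite ler_wpM2r // (le_trans (ltW pow0)).
have ya : y = a.
  apply: le_anti; rewrite ay andbT -(ler_pM2r pow0).
  by apply: le_trans le_prod; rewrite ler_wpM2l // (le_trans (ltW a0)).
by move=> x; rewrite inE => /predU1P[->|/IH]; [|exact].
Qed.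

(** * The bound n |p|_0^(n-1) <= 1 and its equality case *)

Section CriticalModuli.
Variable R : realType.
Local Notation C := R[i].
Local Notation normc := (@Normc.normc R).

Lemma normc_prod (I : Type) (s : seq I) (F : I -> C) :
  normc (\prod_(i <- s) F i) = \prod_(i <- s) normc (F i).
Proof. exact: (big_morph _ (@Normc.normcM R) (@Normc.normc1 R)). Qed.

Lemma normc_nat (n : nat) : normc n%:R = n%:R.
Proof. by rewrite normcMn Normc.normc1. Qed.

Lemma normc_prod_XsubC (s : seq C) :
  normc (\prod_(z <- s) ('X - z%:P))`_0 = \prod_(z <- s) normc z.
Proof.
rewrite -horner_coef0 horner_prod normc_prod.
by apply: eq_bigr => z _; rewrite !hornerE normcN.
Qed.

Lemma S0_factor N (p : {poly C}) : S0 N.+1 p ->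
  exists s t : seq C,
    [/\ size s = N, size t = N, p = 'X * \prod_(z <- s) ('X - z%:P),
        p^`() = N.+1%:R *: \prod_(w <- t) ('X - w%:P) &
        forall z, z \in s -> normc z <= 1].
Proof.
move=> [pmon psz proots p0].
have [q pE] : exists q, p = 'X * q.
  have /factor_theorem[q ->] : root p 0 by rewrite /root p0.
  by exists q; rewrite subr0 mulrC.
have qmon : q \is monic by rewrite -(monicMl _ (monicX _)) -pE.
have qsz : size q = N.+1.
  by apply/eqP; rewrite -eqSS -psz pE mulrC size_mulX // monic_neq0.
have [s qE] := closed_field_poly_normal q.
rewrite (monicP qmon) scale1r in qE.
have [t dE] := closed_field_poly_normal p^`().
have dN : p^`()`_N = N.+1%:R.
  by rewrite coef_deriv -[N.+1]/(N.+2.-1) -psz -lead_coefE (monicP pmon) psz.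
have dsz : size p^`() = N.+1.
  apply/eqP; rewrite eqn_leq -ltnS -{1}psz lt_size_deriv ?monic_neq0 //=.
  rewrite ltnNge; apply/negP => /leq_sizeP/(_ N (leqnn _)) /eqP.
  by rewrite dN pnatr_eq0.
have dlead : lead_coef p^`() = N.+1%:R by rewrite lead_coefE dsz.
rewrite dlead in dE; exists s, t; split.
- by apply/succn_inj; rewrite -qsz qE size_prod_XsubC.
- by apply/succn_inj; rewrite -dsz dE size_scale ?pnatr_eq0 // size_prod_XsubC.
- by rewrite pE qE.
- exact: dE.
- by move=> z zs; apply: proots; rewrite pE rootM qE root_prod_XsubC zs orbT.
Qed.

Lemma root_deriv_factor N (p : {poly C}) (t : seq C) :
  p^`() = N.+1%:R *: \prod_(w <- t) ('X - w%:P) ->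
  forall w, root p^`() w = (w \in t).
Proof. by move=> -> w; rewrite rootZ ?pnatr_eq0 // root_prod_XsubC. Qed.

Lemma crit_min_ge0 N (p : {poly C}) : (0 < N)%N -> S0 N.+1 p -> 0 <= crit_min p.
Proof.
move=> N0 [_ psz _ _]; have [|w _ ->] := @crit_min_attained R p.
  by rewrite psz.
exact: normc_ge0.
Qed.

(** The coefficient of X in p is the constant term both of p' and of the cofactor of X, which links
    the two products. *)
Lemma crit_min_pow_le N (p : {poly C}) (s t : seq C) :
  (0 < N)%N -> S0 N.+1 p -> size t = N ->
  p = 'X * \prod_(z <- s) ('X - z%:P) ->
  p^`() = N.+1%:R *: \prod_(w <- t) ('X - w%:P) ->
  N.+1%:R * crit_min p ^+ N <= \prod_(z <- s) normc z
    /\ \prod_(z <- s) normc z = N.+1%:R * \prod_(w <- t) normc w.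
Proof.
move=> N0 pS szt pE dE.
have c0 := crit_min_ge0 _ _ N0 pS.
have E : \prod_(z <- s) normc z = N.+1%:R * \prod_(w <- t) normc w.
  rewrite -!normc_prod_XsubC -normc_nat -Normc.normcM -coefZ -dE coef_deriv.
  by rewrite {1}pE coefXM.
split=> //; rewrite E ler_pM2l ?ltr0n // -szt -iter_mulr_1 -count_predT -big_const_seq.
rewrite !big_seq ler_prod // => w wt; rewrite c0 /=; apply: crit_min_le.
by rewrite (root_deriv_factor _ _ _ dE).
Qed.

Lemma crit_min_pow_le1 N (p : {poly C}) :
  (0 < N)%N -> S0 N.+1 p -> N.+1%:R * crit_min p ^+ N <= 1.
Proof.
move=> N0 pS; have [s [t [szs szt pE dE hs]]] := S0_factor _ _ pS.
have [/le_trans -> //] := crit_min_pow_le _ _ _ _ N0 pS szt pE dE.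
by rewrite big_seq prodr_ile1 // => z zs; rewrite normc_ge0 hs.
Qed.

Lemma extremal_moduli N (p : {poly C}) :
  (0 < N)%N -> S0 N.+1 p -> 1 <= N.+1%:R * crit_min p ^+ N ->
  exists s t : seq C,
    [/\ size s = N, size t = N, p = 'X * \prod_(z <- s) ('X - z%:P) &
        p^`() = N.+1%:R *: \prod_(w <- t) ('X - w%:P)] /\
    [/\ forall z, z \in s -> normc z = 1,
        forall w, w \in t -> normc w = crit_min p &
        N.+1%:R * crit_min p ^+ N = 1].
Proof.
move=> N0 pS ge1; have [s [t [szs szt pE dE hs]]] := S0_factor _ _ pS.
have E1 : N.+1%:R * crit_min p ^+ N = 1.
  by apply: le_anti; rewrite ge1 crit_min_pow_le1.
have [le_s E] := crit_min_pow_le _ _ _ _ N0 pS szt pE dE.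
have c0 : 0 < crit_min p.
  rewrite lt_neqAle (crit_min_ge0 _ _ N0 pS) andbT; apply: contra_eq_neq E1 => <-.
  by rewrite expr0n gtn_eqF // mulr0 eq_sym oner_eq0.
exists s, t; do 2!split=> //.
  have s0 z : z \in s -> 0 < normc z.
    move=> zs; rewrite lt_neqAle normc_ge0 andbT eq_sym; apply/eqP => z0.
    move: (lt_le_trans (lt_le_trans ltr01 ge1) le_s).
    by rewrite (perm_big _ (perm_to_rem zs)) big_cons /= z0 mul0r ltxx.
  (* The moduli of the zeros are bounded above by 1, whereas [prod_eq_bound] needs a lower bound;
     hence the passage to inverses. *)
  move=> z zs; apply: invr_inj; rewrite invr1.
  apply: (prod_eq_bound _ 1 [seq (normc z)^-1 | z <- s]) => //.
  - move=> _ /mapP[w ws ->]; rewrite -[1]invr1 lef_pV2 ?posrE ?s0 //.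
    exact: hs.
  - rewrite big_map prodfV expr1n -[leRHS]invr1 lef_pV2 ?posrE //.
      exact: le_trans le_s.
    exact: lt_le_trans (lt_le_trans ltr01 ge1) le_s.
  - exact: (map_f (fun z => (normc z)^-1) zs).
move=> w wt; apply: (prod_eq_bound _ (crit_min p) [seq normc w | w <- t]) => //.
- move=> _ /mapP[v vt ->]; apply: crit_min_le.
  by rewrite (root_deriv_factor _ _ _ dE).
- rewrite big_map size_map szt -(@ler_pM2l _ N.+1%:R) ?ltr0n // -E E1.
  by rewrite big_seq prodr_ile1 // => z zs; rewrite normc_ge0 hs.
- exact: map_f.
Qed.

End CriticalModuli.

(** * Vanishing of the intermediate coefficients *)

Section ExtremalCoefficients.
Variable R : realType.
Local Notation C := R[i].
Local Notation normc := (@Normc.normc R).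

(** The hypothesis is what comparison with z^n + z yields. Index k refers to p / z, hence the shift
    to k + 1 in the coefficients of p. *)
Lemma extremal_coef N (p : {poly C}) :
  (0 < N)%N -> S0 N.+1 p -> 1 <= N.+1%:R * crit_min p ^+ N ->
  [/\ normc p`_1 = 1,
      forall k, (k <= N)%N -> (p`_(N - k).+1)^* = (p`_1)^* * p`_k.+1,
      forall k, (0 < k < N)%N -> (2 * k)%N != N -> p`_k.+1 = 0 &
      forall w, root p^`() w -> N.+1%:R * normc w ^+ N = 1].
Proof.
move=> N0 pS ge1.
have [s [t [[szs szt pE dE] [hs ht cE]]]] := extremal_moduli _ _ _ N0 pS ge1.
set c := crit_min p in ht cE.
have coefS k : p`_k.+1 = (\prod_(z <- s) ('X - z%:P))`_k by rewrite pE coefXM.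
have p1 : normc p`_1 = 1.
  rewrite coefS normc_prod_XsubC big_seq big1 // => z zs; exact: hs.
have conj_coef k : (k <= N)%N -> (p`_(N - k).+1)^* = (p`_1)^* * p`_k.+1.
  rewrite -szs !coefS => kN; rewrite -(self_inversive_coef _ 1) ?expr1n ?mulr1 //.
  by move=> z zs; rewrite mulC_conj_normc hs // expr1n.
have pc0 : (p`_1)^* != 0.
  rewrite fmorph_eq0; apply/eqP => E0; move: p1; rewrite E0 Normc.normc0.
  by move/eqP; rewrite eq_sym oner_eq0.
have coef_eq0 k : (0 < k)%N -> (2 * k < N)%N -> p`_k.+1 = 0.
  move=> k0 k2N; have kN : (k <= N)%N by lia.
  apply/eqP/negP => /negP pk0.
  have dcoef j : (\prod_(w <- t) ('X - w%:P))`_j = j.+1%:R / N.+1%:R * p`_j.+1.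
    have n0 : N.+1%:R != 0 :> C by rewrite pnatr_eq0.
    apply: (mulfI n0).
    by rewrite -coefZ -dE coef_deriv mulrA mulrCA divff // mulr1 mulr_natl.
  have [r rE ht2] : exists2 r : C, r = (c ^+ 2)%:C%C &
      forall w, w \in t -> w * w^* = r.
    by exists (c ^+ 2)%:C%C => // w wt; rewrite mulC_conj_normc ht.
  have := self_inversive_coef _ _ t k ht2; rewrite szt => /(_ kN) /=.
  rewrite !dcoef !rmorphM /= !fmorphV !rmorph_nat conj_coef // => E.
  (* Inserting the relation for the zeros into the one for the critical points leaves conj(p_1)
     p_(k+1) as a common nonzero factor. *)
  have {E} E : (N - k).+1%:R * N.+1%:R * (c ^+ 2) ^+ (N - k) = k.+1%:R :> R.
    apply: (@complexI R); rewrite !rmorphM !rmorph_nat (rmorphXn _ (N - k)) /= -rE.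
    apply: (mulIf pk0); apply: (mulfI pc0); move: E.
    move: (N - k)%N (r ^+ _) => j rj E.
    have n0 : N.+1%:R != 0 :> C by rewrite pnatr_eq0.
    transitivity (N.+1%:R ^+ 2 *
        (j.+1%:R / N.+1%:R * ((p`_1)^* * p`_k.+1) * rj)); first by field.
    by rewrite E; field.
  (* After taking N-th powers and multiplying by n^(N-2k), the radius c enters only through n c^N =
     1 and disappears. *)
  apply: (ratio_pow_neq N k k0 k2N); apply/eqP; rewrite -(@eqr_nat R).
  rewrite natrM !natrX -subSn // in E *.
  have ej : (2 * (N - k) = N + (N - 2 * k))%N by lia.
  apply/eqP; rewrite -E -exprM ej; move: (N.+1 - k)%N (N - 2 * k)%N => a e.
  have -> : (a%:R * N.+1%:R * c ^+ (N + e)) ^+ N * N.+1%:R ^+ e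
      = a%:R ^+ N * (N.+1%:R * c ^+ N) ^+ (N + e).
    by rewrite !exprMn -!exprM (mulnC N (N + e)) exprD; ring.
  by rewrite cE expr1n mulr1.
split=> //.
- move=> k /andP[k0 kN] k2; case: (ltngtP (2 * k)%N N) k2 => // k2 _.
    exact: coef_eq0.
  (* An index above the middle is reflected to N - k, below the middle. *)
  have := conj_coef k (ltnW kN); rewrite coef_eq0; [|lia..].
  by rewrite rmorph0 => /esym/eqP; rewrite mulf_eq0 (negbTE pc0) /= => /eqP.
- move=> w; rewrite (root_deriv_factor _ _ _ _ dE) => /ht ->; exact: cE.
Qed.

End ExtremalCoefficients.

(** * Unimodular numbers, real quadratics and criteria for maximality *)

Section Maximality.
Variable R : realType.
Local Notation C := R[i].
Local Notation normc := (@Normc.normc R).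

Lemma normcX (z : C) (k : nat) : normc (z ^+ k) = normc z ^+ k.
Proof. by elim: k => [|k IH]; rewrite ?Normc.normc1 // !exprS Normc.normcM IH. Qed.

Lemma normc_expi (t : R) : normc (expi t) = 1.
Proof. by rewrite /expi /= cos2Dsin2 sqrtr1. Qed.

Lemma expi_double (t : R) : expi (2 * t) = expi t ^+ 2.
Proof. rewrite /expi (_ : 2 * t = t + t); last by ring.
by rewrite cosD sinD expr2; simpc; congr Complex; ring. Qed.

Lemma expi_surj (z : C) : normc z = 1 -> exists t : R, z = expi t.
Proof.
case: z => x y /= /(congr1 (fun s => s ^+ 2)).
rewrite sqr_sqrtr ?addr_ge0 ?sqr_ge0 // expr1n => xy1.
have x1 : -1 <= x <= 1.
  by apply/andP; split; nra.
have cx : cos (acos x) = x by rewrite acosK.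
have sx : sin (acos x) = `|y|.
  by rewrite sin_acos // -sqrtr_sqr; congr Num.sqrt; lra.
(* The sine of [acos x] is nonnegative, so a negative imaginary part calls for the opposite
   angle. *)
have [y0|y0] := leP 0 y.
  by exists (acos x); rewrite /expi cx sx ger0_norm.
by exists (- acos x); rewrite /expi cosN sinN cx sx ltr0_norm ?opprK.
Qed.

(** The roots are conjugate or equal, with real part -b/(2a) and product c/a. *)
Lemma quadratic_root_modulus (a b c : R) (v : C) :
  0 < a -> b ^+ 2 <= 4 * a * c ->
  a%:C%C * v ^+ 2 + b%:C%C * v + c%:C%C = 0 -> a * normc v ^+ 2 = c.
Proof.
case: v => x y a0 disc; rewrite /= sqr_sqrtr ?addr_ge0 ?sqr_ge0 //.
rewrite expr2; simpc => /eqP; rewrite eq_complex /= => /andP[/eqP re /eqP im].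
have y_or : y * (2 * a * x + b) = 0 by rewrite -im; ring.
have vertex : 2 * a * x + b = 0.
  have /eqP := y_or; rewrite mulf_eq0 => /orP[/eqP y0|/eqP //].
  apply/eqP; rewrite -sqrf_eq0 eq_le sqr_ge0 andbT.
  have -> : (2 * a * x + b) ^+ 2 =
      b ^+ 2 - 4 * a * c + 4 * a * (a * (x * x - y * y) + b * x + c).
    by rewrite y0; ring.
  by rewrite re mulr0 addr0 subr_le0.
have bE : b = - (2 * a * x) by apply/eqP; rewrite -addr_eq0 addrC vertex.
by rewrite bE in re; apply/eqP; rewrite -subr_eq0 -oppr_eq0 -re; apply/eqP; ring.
Qed.

(** With a positive discriminant, two distinct real roots would both satisfy b t + 2c = 0. This
    forces b = 0, and then the discriminant -4ac is negative. *)
Lemma quadratic_disc_le (a b c : R) : 0 < a -> 0 < c ->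
  (forall t, a * t ^+ 2 + b * t + c = 0 -> a * t ^+ 2 = c) ->
  b ^+ 2 <= 4 * a * c.
Proof.
move=> a0 c0 h; rewrite leNgt; apply/negP => disc.
have [d d0 dE] : exists2 d : R, 0 < d & d ^+ 2 = b ^+ 2 - 4 * a * c.
  exists (Num.sqrt (b ^+ 2 - 4 * a * c)); first by rewrite sqrtr_gt0 subr_gt0.
  by rewrite sqr_sqrtr // subr_ge0 ltW.
have root_lin e : e ^+ 2 = d ^+ 2 -> b * ((e - b) / (2 * a)) + 2 * c = 0.
  move=> eE; set t := _ / _.
  have tE : a * t ^+ 2 + b * t + c = 0.
    transitivity ((e ^+ 2 - (b ^+ 2 - 4 * a * c)) / (4 * a)).
      by rewrite /t; field; rewrite gt_eqF.
    by rewrite eE dE subrr mul0r.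
  by have := h _ tE; lra.
have b0 : b = 0.
  have := congr2 (fun u v => a * (u - v) / d) (root_lin d erefl) (root_lin (- d) (sqrrN d)).
  rewrite subrr mulr0 mul0r => <-; field.
  by rewrite !gt_eqF.
have ac0 : 0 < a * c by rewrite mulr_gt0.
by move: disc; rewrite b0; nra.
Qed.

(** The case u = 1 is the competitor showing that the bound is attained; general u gives the family
    of even degree. *)
Lemma S0_XnDX N (u : C) : (0 < N)%N -> normc u = 1 ->
  S0 N.+1 ('X^(N.+1) + u *: 'X) /\
  forall w, root ('X^(N.+1) + u *: 'X)^`() w -> N.+1%:R * normc w ^+ N = 1.
Proof.
move=> N0 u1.
have szu : (size (u *: 'X : {poly C}) <= 2)%N.
  by rewrite (leq_trans (size_scale_leq _ _)) // size_polyX.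
have lt_sz : (size (u *: 'X : {poly C}) < size ('X^(N.+1) : {poly C}))%N.
  by rewrite size_polyXn; apply: leq_ltn_trans szu _.
split=> [|w].
  split.
  - by rewrite monicE lead_coefDl // lead_coefXn.
  - by rewrite size_polyDl // size_polyXn.
  - move=> z; rewrite rootE !hornerE => zE.
    have [->|z0] := eqVneq z 0; first by rewrite Normc.normc0.
    have {zE} : z ^+ N = - u.
      apply/eqP; rewrite -addr_eq0; move: zE.
      by rewrite exprSr -mulrDl mulf_eq0 (negbTE z0) orbF.
    move=> /(congr1 normc); rewrite normcX normcN u1 => /eqP.
    by rewrite pexpr_eq1 ?normc_ge0 // => /eqP ->.
  - by rewrite !hornerE expr0n /= ?mulr0 ?addr0.
rewrite derivD derivXn derivZ derivX rootE !hornerE addr_eq0 => /eqP.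
move=> /(congr1 normc); rewrite normcN u1 hornerMn hornerXn -mulr_natl Normc.normcM normc_nat.
by rewrite normcX.
Qed.

Lemma crit_min_pow_eq1 N (p : {poly C}) : (0 < N)%N -> S0 N.+1 p ->
  (forall w, root p^`() w -> N.+1%:R * normc w ^+ N = 1) ->
  N.+1%:R * crit_min p ^+ N = 1.
Proof.
move=> N0 [_ psz _ _] hp; have [|w wp ->] := @crit_min_attained R p.
  by rewrite psz.
exact: hp.
Qed.

Lemma zero_maximal_ge1 N (p : {poly C}) : (0 < N)%N ->
  zero_maximal N.+1 p -> 1 <= N.+1%:R * crit_min p ^+ N.
Proof.
move=> N0 [pS pmax]; have [qS hq] := S0_XnDX N 1 N0 (@Normc.normc1 R).
rewrite -[leLHS](crit_min_pow_eq1 _ _ N0 qS hq) ler_pM2l ?ltr0n //.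
by rewrite lerXn2r ?nnegrE ?(crit_min_ge0 _ _ _ N0) // pmax.
Qed.

Lemma zero_maximal_of_moduli N (p : {poly C}) : (0 < N)%N -> S0 N.+1 p ->
  (forall w, root p^`() w -> N.+1%:R * normc w ^+ N = 1) ->
  zero_maximal N.+1 p.
Proof.
move=> N0 pS hp; split=> // q qS.
rewrite -(@ler_pXn2r _ N) ?nnegrE ?(crit_min_ge0 _ _ _ N0) //.
rewrite -(@ler_pM2l _ N.+1%:R) ?ltr0n // (crit_min_pow_eq1 _ _ N0 pS hp).
exact: crit_min_pow_le1.
Qed.

(** With j = k + 1 the excluded index is 2k = N, the middle of p / z. *)
Lemma zero_maximal_coef N (p : {poly C}) (j : nat) :
  (0 < N)%N -> zero_maximal N.+1 p ->
  (2 * j != N.+2)%N -> p`_j = (j == N.+1)%:R + p`_1 * (j == 1%N)%:R.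
Proof.
move=> N0 pmax j2; have [[pmon psz _ p0] _] := pmax.
have [_ _ pmid _] := extremal_coef _ _ _ N0 pmax.1 (zero_maximal_ge1 _ _ N0 pmax).
case: j j2 => [|j] j2; first by rewrite -horner_coef0 p0 mulr0 addr0.
rewrite !eqSS; have [->|jN] := eqVneq j N.
  rewrite gtn_eqF // mulr0 addr0 -[N.+1]/(N.+2.-1) -psz -lead_coefE.
  exact/monicP.
have [->|j0] := eqVneq j 0%N; first by rewrite mulr1 add0r.
rewrite mulr0 addr0; case: (ltngtP j N) jN => // [jN|Nj] _.
  by apply: pmid; lia.
by rewrite nth_default // psz.
Qed.

End Maximality.

(** * The trinomials of odd degree *)

Section Trinomials.
Variable R : realType.
Local Notation C := R[i].
Local Notation normc := (@Normc.normc R).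

(** In v = z^m / e, both p / (e^2 z) and p' / e^2 are real quadratics: v^2 + lambda v + 1 and (2m+1)
    v^2 + (m+1) lambda v + 1. *)
Lemma trinomial_zero_maximal (m : nat) (lambda : R) (e : C) :
  (0 < m)%N -> normc e = 1 ->
  (m.+1%:R * lambda) ^+ 2 <= 4 * (2 * m).+1%:R ->
  zero_maximal (2 * m).+1
    ('X^((2 * m).+1) + (lambda%:C%C * e) *: 'X^(m.+1) + e ^+ 2 *: 'X).
Proof.
move=> m0 e1 disc; set p : {poly C} := _ + _.
have e0 : e != 0.
  by apply/eqP => e0; move/eqP: e1; rewrite e0 Normc.normc0 eq_sym oner_eq0.
have modV w : normc (w ^+ m / e) = normc w ^+ m.
  by rewrite Normc.normcM Normc.normcV e1 invr1 mulr1 normcX.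
pose q : {poly C} := (lambda%:C%C * e) *: 'X^(m.+1) + e ^+ 2 *: 'X.
have low : (size q < size ('X^((2 * m).+1) : {poly C}))%N.
  rewrite size_polyXn ltnS (leq_trans (size_polyD _ _)) // geq_max.
  rewrite !(leq_trans (size_scale_leq _ _)) ?size_polyX ?size_polyXn //; lia.
have pE : p = 'X^((2 * m).+1) + q by rewrite /p /q addrA.
apply: zero_maximal_of_moduli; first by rewrite muln_gt0.
  split.
  - by rewrite pE monicE lead_coefDl // lead_coefXn.
  - by rewrite pE size_polyDl // size_polyXn.
  - move=> z; rewrite rootE !hornerE => /eqP zE.
    have [->|z0] := eqVneq z 0; first by rewrite Normc.normc0.
    have m1 : 0 < m.+1%:R :> R by rewrite ltr0n.
    (* The discriminant bound for p' implies the one for p / z, because 2m + 1 <= (m + 1)^2. *)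
    have disc1 : lambda ^+ 2 <= 4 * 1 * 1.
      rewrite !mulr1 -(@ler_pM2l _ (m.+1%:R ^+ 2)) ?exprn_gt0 // -exprMn.
      by apply: le_trans disc _; rewrite mulrC ler_wpM2r // -natrX ler_nat; nia.
    have := quadratic_root_modulus _ _ _ _ (z ^+ m / e) ltr01 disc1.
    rewrite rmorph1 modV -exprM !mul1r => zm.
    suff /zm/eqP : (z ^+ m / e) ^+ 2 + lambda%:C%C * (z ^+ m / e) + 1 = 0.
      by rewrite pexpr_eq1 ?normc_ge0 ?muln_gt0 ?m0 // => /eqP ->.
    have ez : e ^+ 2 * z != 0 by rewrite mulf_neq0 ?expf_neq0.
    apply: (mulIf ez); rewrite mul0r -zE !exprS mulnC exprM; field.
    exact: e0.
  - by rewrite /p !hornerE !expr0n /= ?mulr0 ?addr0.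
move=> w; rewrite !derivD derivXn !derivZ derivX derivXn rootE !hornerE !hornerMn !hornerXn.
move=> /eqP wE.
have n0 : 0 < (2 * m).+1%:R :> R by rewrite ltr0n.
have := quadratic_root_modulus _ _ (m.+1%:R * lambda) 1 (w ^+ m / e) n0.
rewrite mulr1 => /(_ disc); rewrite modV -exprM [in _ ^+ (m * 2)]mulnC; apply.
have e2 : e ^+ 2 != 0 by rewrite expf_neq0.
apply: (mulIf e2); rewrite mul0r -wE /= -!(mulr_natl (w ^+ _)) mulnC exprM.
rewrite rmorphM rmorph1 !rmorph_nat; field.
exact: e0.
Qed.

Lemma trinomial_lambda_bound (m : nat) (lambda : R) (e : C) :
  (0 < m)%N -> normc e = 1 ->
  zero_maximal (2 * m).+1
    ('X^((2 * m).+1) + (lambda%:C%C * e) *: 'X^(m.+1) + e ^+ 2 *: 'X) ->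
  (m.+1%:R * lambda) ^+ 2 <= 4 * (2 * m).+1%:R.
Proof.
move=> m0 e1 pmax; have n0 : 0 < (2 * m).+1%:R :> R by rewrite ltr0n.
have N0 : (0 < 2 * m)%N by rewrite muln_gt0.
have [_ _ _ crit] := extremal_coef _ _ _ N0 pmax.1 (zero_maximal_ge1 _ _ _ N0 pmax).
rewrite -[leRHS]mulr1; apply: quadratic_disc_le => // t tE.
(* A real root t of the quadratic lifts to a critical point w with w^m = t e, whose modulus is known
   by extremality. *)
pose w := m.-root (t%:C%C * e).
have wm : w ^+ m = t%:C%C * e by rewrite rootCK.
have normcR (x : R) : normc x%:C%C = `|x| by rewrite /= expr0n addr0 sqrtr_sqr.
have <- : normc w ^+ (2 * m) = t ^+ 2.
  rewrite mulnC exprM -normcX wm Normc.normcM e1 mulr1 normcR.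
  by rewrite real_normK ?num_real.
apply: crit.
rewrite !derivD derivXn !derivZ derivX derivXn rootE !hornerE !hornerMn !hornerXn.
apply/eqP; rewrite /= -!(mulr_natl (w ^+ _)) [in w ^+ (2 * m)]mulnC exprM wm.
transitivity (e ^+ 2 * ((2 * m).+1%:R * t ^+ 2 + m.+1%:R * lambda * t + 1)%:C%C).
  by rewrite !rmorphD !rmorphM rmorph1 !rmorph_nat /=; ring.
by rewrite tE rmorph0 mulr0.
Qed.

Lemma sqr_bound_sqrt (a b n : R) : 0 < a -> 0 <= n ->
  ((a * b) ^+ 2 <= 4 * n) = (`|b| <= 2 * Num.sqrt n / a).
Proof.
move=> a0 n0; rewrite ler_pdivlMr //.
rewrite -[in RHS]ler_sqr ?nnegrE ?mulr_ge0 ?sqrtr_ge0 ?(ltW a0) //.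
rewrite !exprMn real_normK ?num_real // sqr_sqrtr // mulrC.
by congr (_ <= _ * _); ring.
Qed.

End Trinomials.

Theorem theorem2p1 (R : realType) (n : nat) (hn : (2 <= n)%N) :
  (forall m : nat, (1 <= m)%N -> n = (2 * m)%N ->
     forall p : {poly R[i]},
       zero_maximal n p <->
       exists theta : R, p = 'X^(2 * m) + expi theta *: 'X)
  /\
  (forall m : nat, (1 <= m)%N -> n = (2 * m + 1)%N ->
     forall p : {poly R[i]},
       zero_maximal n p <->
       exists lambda theta : R,
         `|lambda| <= 2 * Num.sqrt (2 * m + 1)%:R / (m + 1)%:R /\
         p = 'X^(2 * m + 1)
             + (real_complex R lambda * expi theta) *: 'X^(m + 1)
             + expi (2 * theta) *: 'X).
Proof.
split=> m m0 nE p; rewrite {n}nE in hn *.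
  have [N NE] : exists N, (2 * m = N.+1)%N by exists (2 * m).-1%N; lia.
  rewrite NE; have N0 : (0 < N)%N by lia.
  split=> [pmax|[theta ->]]; last first.
    have [pS hp] := S0_XnDX _ N _ N0 (normc_expi _ theta).
    exact: zero_maximal_of_moduli.
  have [p1 _ _ _] := extremal_coef _ _ _ N0 pmax.1 (zero_maximal_ge1 _ _ _ N0 pmax).
  have [theta thetaE] := expi_surj _ _ p1; exists theta; rewrite -thetaE.
  apply/polyP => j; rewrite coefD coefXn coefZ coefX.
  have [j2|j2] := eqVneq (2 * j)%N N.+2; last exact: zero_maximal_coef.
  (* Here N + 2 = 2m + 1 is odd, so there is no middle coefficient. *)
  by lia.
rewrite !addn1 in hn *; have N0 : (0 < 2 * m)%N by rewrite muln_gt0.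
have bndE lambda := sqr_bound_sqrt R m.+1%:R lambda (2 * m).+1%:R (ltr0Sn _ _) (ler0n _ _).
split=> [pmax|[lambda [theta [bnd ->]]]]; last first.
  rewrite expi_double; apply: trinomial_zero_maximal => //.
    exact: normc_expi.
  by rewrite bndE.
have [p1 pconj _ _] := extremal_coef _ _ _ N0 pmax.1 (zero_maximal_ge1 _ _ _ N0 pmax).
have [phi phiE] := expi_surj _ _ p1.
(* Halving the argument makes the coefficient of X equal to e^2. *)
pose theta := phi / 2; set e := expi theta.
have eE : p`_1 = e ^+ 2 by rewrite phiE -expi_double; congr expi; rewrite /theta; field.
have e1 : Normc.normc e = 1 by exact: normc_expi.
have ee : e * e^* = 1 by rewrite mulC_conj_normc e1 expr1n.
have [lambda aE] : exists lambda : R, p`_m.+1 = lambda%:C%C * e.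
  have := pconj m; rewrite eE (_ : (2 * m - m)%N = m); last by lia.
  rewrite leq_pmull // => /(_ isT) aconj.
  (* The conjugation relation sends the middle coefficient to itself, so its quotient by e is
     real. *)
  have : (p`_m.+1 * e^*)^* = p`_m.+1 * e^*.
    rewrite rmorphM /= conjCK aconj rmorphXn /=.
    by rewrite -[RHS]mulr1 -ee; ring.
  move=> /CrealP/complex_realP[lambda lE]; exists lambda.
  by rewrite -lE -mulrA [e^* * e]mulrC ee mulr1.
have pE : p = 'X^((2 * m).+1) + (lambda%:C%C * e) *: 'X^(m.+1) + e ^+ 2 *: 'X.
  apply/polyP => j; rewrite !coefD !coefZ coefX !coefXn -aE -eE.
  have [->|jm] := eqVneq j m.+1.
    by rewrite ltn_eqF ?gtn_eqF ?mulr1 ?mulr0 ?addr0 ?add0r //; lia.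
  rewrite mulr0 addr0; apply: zero_maximal_coef => //; lia.
exists lambda, theta; split; last by rewrite expi_double.
rewrite -bndE; apply: (trinomial_lambda_bound R m lambda e) => //.
by rewrite -pE.
Qed.
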